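(* In guarded MTT, at mode $t$, for $A : U$ and $M : \triangleright\mathsf{El}(A) \to \mathsf{El}(A)$, $\mathsf{löb}(M)$ is the unique guarded fixed point of $M$, i.e. the type $$(x : \mathsf{El}(A)) \to \mathsf{Eq}_{\mathsf{El}(A)}(M(\mathsf{next}(x)), x) \to \mathsf{Eq}_{\mathsf{El}(A)}(\mathsf{löb}(M), x)$$ is inhabited (for every $A : U$).
   Context: MTT over a mode theory $\mathcal{M}$ is a dependent type theory with, at each mode, $\Pi$, $\Sigma$, identity types, booleans and a Coquand-style universe $U$ with decoding $\mathsf{El}$; for each modality $\mu : n\to m$ a lock $\Gamma.\{\mu\}$ (contexts at $m$ to contexts at $n$, with $\Gamma.\{1\}=\Gamma$, $\Gamma.\{\mu\}.\{\nu\}=\Gamma.\{\mu\circ\nu\}$), key substitutions for 2-cells $\alpha$ (action written $(-)^\alpha$), variables $x:(\mu\mid A)$ usable under a lock $\{\nu\}$ via a 2-cell $\mu\Rightarrow\nu$, modal types $\langle\mu\mid A\rangle$ with introduction $\mathsf{mod}_\mu$ and eliminator $\mathsf{let}_\nu\ \mathsf{mod}_\mu(x)\leftarrow M_0\ \mathsf{in}\ M_1$ (with $\beta$, no $\eta$). Guarded MTT is MTT over the poset-enriched mode theory $\mathcal{M}_g$ with modes $s,t$, 1-cells $\ell:t\to t$, $\gamma:t\to s$, $\delta:s\to t$, equations $\gamma\circ\delta=1_s$, $\gamma\circ\ell=\gamma$, and 2-cells $\delta\circ\gamma\le 1_t$, $1_t\le\ell$; identity types are replaced by extensional identity types $\mathsf{Eq}_A(M,N)$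 with $\mathsf{refl}$ and equality reflection; and at mode $t$ it is extended with Löb induction: for every type $A$ at mode $t$ a term $\mathsf{löb} : (\triangleright A^{1\le\ell}\to A)\to A$ with $\mathsf{löb}(M) = M(\mathsf{next}(\mathsf{löb}(M)))$. Here $\triangleright A := \langle\ell\mid A\rangle$, $A^{1\le\ell}$ is the action of the key substitution for $1\le\ell$ (elided in the claim), and $\mathsf{next}(x) := \mathsf{let}_1\ \mathsf{mod}_1(z)\leftarrow\mathsf{mod}_1(x)\ \mathsf{in}\ \mathsf{mod}_\ell(z^{1\le\ell})$. *)

(* Defs.v *)
(** Guarded MTT: multimodal type theory over a poset-enriched mode theory, given
    as an algebraic (explicit-substitution) calculus.  Raw expressions are
    intrinsically moded; the judgments are mutually inductive.  Every binding
    construct carries all of its type annotations, so that raw expressions keep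
    the arguments which are implicit in the generalized algebraic presentation
    (with equality reflection, unannotated syntax would have a different
    equational theory). *)

Inductive mode : Set := s | t.

(** [cell n m] is the type of (representatives of) 1-cells n → m. *)
Inductive cell : mode -> mode -> Set :=
| one {m} : cell m m
| cmp {o n m} (μ : cell n m) (ν : cell o n) : cell o m
| ℓ : cell t t
| γ : cell t s
| δ : cell s t.

Notation "μ ∘ ν" := (cmp μ ν) (at level 40, left associativity).

(** The enriching preorder presented by the generating 2-cells and equations;
    an equation of 1-cells is a pair of inequalities.  As hom-categories are
    posets, a 2-cell μ ⇒ ν is just a proof of [μ ≤ ν]. *)
Reserved Notation "μ ≤ ν" (at level 70, no associativity).
Inductive cell_le : forall {n m}, cell n m -> cell n m -> Prop :=
| le_refl {n m} (μ : cell n m) : μ ≤ μ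
| le_trans {n m} (μ ν ρ : cell n m) : μ ≤ ν -> ν ≤ ρ -> μ ≤ ρ
| le_cmp {o n m} (μ μ' : cell n m) (ν ν' : cell o n) :
    μ ≤ μ' -> ν ≤ ν' -> μ ∘ ν ≤ μ' ∘ ν'
| le_idl {n m} (μ : cell n m) : one ∘ μ ≤ μ
| ge_idl {n m} (μ : cell n m) : μ ≤ one ∘ μ
| le_idr {n m} (μ : cell n m) : μ ∘ one ≤ μ
| ge_idr {n m} (μ : cell n m) : μ ≤ μ ∘ one
| le_assoc {p o n m} (μ : cell n m) (ν : cell o n) (ρ : cell p o) :
    (μ ∘ ν) ∘ ρ ≤ μ ∘ (ν ∘ ρ)
| ge_assoc {p o n m} (μ : cell n m) (ν : cell o n) (ρ : cell p o) :
    μ ∘ (ν ∘ ρ) ≤ (μ ∘ ν) ∘ ρ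
| le_γδ : γ ∘ δ ≤ one
| ge_γδ : one ≤ γ ∘ δ
| le_γℓ : γ ∘ ℓ ≤ γ
| ge_γℓ : γ ≤ γ ∘ ℓ
| le_δγ : δ ∘ γ ≤ one
| le_ℓ : one ≤ ℓ
where "μ ≤ ν" := (cell_le μ ν).

Definition cell_eq {n m} (μ ν : cell n m) : Prop := μ ≤ ν /\ ν ≤ μ.
Notation "μ ≈ ν" := (cell_eq μ ν) (at level 70, no associativity).

Inductive ty : mode -> Type :=
| tsub {m} (A : ty m) (σ : sub m) : ty m
| Pi {m} (A B : ty m) : ty m
| Sig {m} (A B : ty m) : ty m
| Bool {m} : ty m
| Eq {m} (A : ty m) (M N : tm m) : ty m
| U {m} : ty m
| El {m} (M : tm m) : ty m
| Modal {n m} (μ : cell n m) (A : ty n) : ty m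
with tm : mode -> Type :=
| msub {m} (M : tm m) (σ : sub m) : tm m
| var {n m} (μ : cell n m) (A : ty n) : tm n
| lam {m} (A B : ty m) (M : tm m) : tm m
| app {m} (A B : ty m) (M N : tm m) : tm m
| pair {m} (A B : ty m) (M N : tm m) : tm m
| fst {m} (A B : ty m) (M : tm m) : tm m
| snd {m} (A B : ty m) (M : tm m) : tm m
| tt {m} : tm m
| ff {m} : tm m
| bif {m} (C : ty m) (M0 M1 N : tm m) : tm m
| refl {m} (A : ty m) (M : tm m) : tm m
| code {m} (A : ty m) : tm m
| mod {n m} (μ : cell n m) (A : ty n) (M : tm n) : tm m
| letmod {n m o} (ν : cell m o) (μ : cell n m) (A : ty n) (B : ty o)
    (M0 : tm m) (M1 : tm o) : tm o
| löb (A : ty t) : tm t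
with sub : mode -> Type :=
| id {m} : sub m
| comp {m} (σ τ : sub m) : sub m
| bang {m} : sub m
| wk {n m} (μ : cell n m) (A : ty n) : sub m
| ext {n m} (μ : cell n m) (A : ty n) (σ : sub m) (M : tm n) : sub m
| lock {n m} (σ : sub m) (μ : cell n m) : sub n
| key {n m} (μ ν : cell n m) : sub n.

(** [Γ ◂ μ] is Γ.{μ} and [Γ ▸[ μ ] A] is Γ.(μ ∣ A). *)
Inductive ctx : mode -> Type :=
| cemp {m} : ctx m
| clock {n m} (Γ : ctx m) (μ : cell n m) : ctx n
| cext {n m} (Γ : ctx m) (μ : cell n m) (A : ty n) : ctx m.

Notation "Γ ◂ μ" := (clock Γ μ) (at level 45, left associativity).
Notation "Γ ▸[ μ ] A" := (cext Γ μ A) (at level 45, left associativity).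
Notation "Γ ▸ A" := (cext Γ one A) (at level 45, left associativity).
Notation "A ⟦ σ ⟧" := (tsub A σ) (at level 8, left associativity).
Notation "M ⦃ σ ⦄" := (msub M σ) (at level 8, left associativity).
Notation "σ ⊙ τ" := (comp σ τ) (at level 40, left associativity).
Notation "σ ◃ μ" := (lock σ μ) (at level 40, left associativity).

(** Γ.(μ ∣ A[σ.{μ}]) → Δ.(μ ∣ A), for σ : Γ → Δ. *)
Definition up {n m} (μ : cell n m) (A : ty n) (σ : sub m) : sub m :=
  ext μ A (σ ⊙ wk μ A⟦σ ◃ μ⟧) (var μ A⟦σ ◃ μ⟧).

(** Γ → Γ.(μ ∣ A), for M : A over Γ.{μ}. *)
Definition inst {n m} (μ : cell n m) (A : ty n) (M : tm n) : sub m :=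
  ext μ A id M.

Definition arr {m} (A B : ty m) : ty m := Pi A B⟦wk one A⟧.
Definition ap {m} (A B : ty m) (M N : tm m) : tm m := app A B⟦wk one A⟧ M N.

(** The substitution Γ.(ν∘μ ∣ A) → Γ.(ν ∣ ⟨μ ∣ A⟩) along which the branch of
    the modal eliminator is typed. *)
Definition modsub {n m o} (ν : cell m o) (μ : cell n m) (A : ty n) : sub o :=
  ext ν (Modal μ A) (wk (ν ∘ μ) A)
    (mod μ A⟦wk (ν ∘ μ) A ◃ ν ◃ μ⟧ (var (ν ∘ μ) A)).

(** For a 2-cell α : μ ⇒ ν, [key μ ν] is the substitution Γ.{ν} → Γ.{μ}, and A^α
    is [A⟦key μ ν⟧].  So [later A] is ▷ A^{1≤ℓ}, for A over Γ = Γ.{1}. *)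
Definition later (A : ty t) : ty t := Modal ℓ A⟦key one ℓ⟧.

(** let_1 mod_1(z) ← mod_1(N) in mod_ℓ(z^{1≤ℓ}).  The eliminator binds z with
    modality 1∘1, a 1-cell equal to 1. *)
Definition next (A : ty t) (N : tm t) : tm t :=
  letmod one one A (later A)⟦wk one (Modal one A)⟧
    (mod one A N)
    (mod ℓ A⟦key one ℓ⟧⟦wk (one ∘ one) A ◃ ℓ⟧
       (var (one ∘ one) A)⦃key (one ∘ one) ℓ⦄).

Definition löb_at (A : ty t) (M : tm t) : tm t :=
  ap (arr (later A) A) A (löb A) M.

(** Types are stratified à la Coquand: [U] classifies the small types, and every
    small type is also, silently, a large one. *)
Inductive size : Set := small | large.

Inductive wf_ctx : forall {m}, ctx m -> Prop :=
| wf_emp {m} : wf_ctx (@cemp m)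
| wf_clock {n m} (Γ : ctx m) (μ : cell n m) : wf_ctx Γ -> wf_ctx (Γ ◂ μ)
| wf_cext {n m} (Γ : ctx m) (μ : cell n m) A :
    wf_ctx Γ -> wf_ty large (Γ ◂ μ) A -> wf_ctx (Γ ▸[μ] A)

with eq_ctx : forall {m}, ctx m -> ctx m -> Prop :=
| ec_refl {m} (Γ : ctx m) : wf_ctx Γ -> eq_ctx Γ Γ
| ec_sym {m} (Γ Γ' : ctx m) : eq_ctx Γ Γ' -> eq_ctx Γ' Γ
| ec_trans {m} (Γ Γ' Γ'' : ctx m) :
    eq_ctx Γ Γ' -> eq_ctx Γ' Γ'' -> eq_ctx Γ Γ''
| ec_clock {n m} (Γ Γ' : ctx m) (μ μ' : cell n m) :
    eq_ctx Γ Γ' -> μ ≈ μ' -> eq_ctx (Γ ◂ μ) (Γ' ◂ μ')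
| ec_cext {n m} (Γ Γ' : ctx m) (μ μ' : cell n m) A A' :
    eq_ctx Γ Γ' -> μ ≈ μ' -> eq_ty large (Γ ◂ μ) A A' ->
    eq_ctx (Γ ▸[μ] A) (Γ' ▸[μ'] A')
| ec_one {m} (Γ : ctx m) : wf_ctx Γ -> eq_ctx (Γ ◂ one) Γ
| ec_cmp {o n m} (Γ : ctx m) (μ : cell n m) (ν : cell o n) :
    wf_ctx Γ -> eq_ctx (Γ ◂ μ ◂ ν) (Γ ◂ (μ ∘ ν))

with wf_sub : forall {m}, ctx m -> sub m -> ctx m -> Prop :=
| ws_conv {m} (Γ Γ' Δ Δ' : ctx m) σ :
    wf_sub Γ σ Δ -> eq_ctx Γ Γ' -> eq_ctx Δ Δ' -> wf_sub Γ' σ Δ'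
| ws_id {m} (Γ : ctx m) : wf_ctx Γ -> wf_sub Γ id Γ
| ws_comp {m} (Γ Δ Ξ : ctx m) σ τ :
    wf_sub Γ τ Δ -> wf_sub Δ σ Ξ -> wf_sub Γ (σ ⊙ τ) Ξ
| ws_bang {m} (Γ : ctx m) : wf_ctx Γ -> wf_sub Γ bang cemp
| ws_wk {n m} (Γ : ctx m) (μ : cell n m) A :
    wf_ctx (Γ ▸[μ] A) -> wf_sub (Γ ▸[μ] A) (wk μ A) Γ
| ws_ext {n m} (Γ Δ : ctx m) (μ : cell n m) A σ M :
    wf_sub Γ σ Δ -> wf_ty large (Δ ◂ μ) A -> wf_tm (Γ ◂ μ) M A⟦σ ◃ μ⟧ ->
    wf_sub Γ (ext μ A σ M) (Δ ▸[μ] A)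
| ws_lock {n m} (Γ Δ : ctx m) (μ : cell n m) σ :
    wf_sub Γ σ Δ -> wf_sub (Γ ◂ μ) (σ ◃ μ) (Δ ◂ μ)
| ws_key {n m} (Γ : ctx m) (μ ν : cell n m) :
    wf_ctx Γ -> μ ≤ ν -> wf_sub (Γ ◂ ν) (key μ ν) (Γ ◂ μ)

with eq_sub : forall {m}, ctx m -> sub m -> sub m -> ctx m -> Prop :=
| es_refl {m} (Γ Δ : ctx m) σ : wf_sub Γ σ Δ -> eq_sub Γ σ σ Δ
| es_sym {m} (Γ Δ : ctx m) σ σ' : eq_sub Γ σ σ' Δ -> eq_sub Γ σ' σ Δ
| es_trans {m} (Γ Δ : ctx m) σ σ' σ'' :
    eq_sub Γ σ σ' Δ -> eq_sub Γ σ' σ'' Δ -> eq_sub Γ σ σ'' Δ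
| es_conv {m} (Γ Γ' Δ Δ' : ctx m) σ σ' :
    eq_sub Γ σ σ' Δ -> eq_ctx Γ Γ' -> eq_ctx Δ Δ' -> eq_sub Γ' σ σ' Δ'
| es_comp {m} (Γ Δ Ξ : ctx m) σ σ' τ τ' :
    eq_sub Γ τ τ' Δ -> eq_sub Δ σ σ' Ξ -> eq_sub Γ (σ ⊙ τ) (σ' ⊙ τ') Ξ
| es_wk {n m} (Γ : ctx m) (μ μ' : cell n m) A A' :
    wf_ctx Γ -> μ ≈ μ' -> eq_ty large (Γ ◂ μ) A A' ->
    eq_sub (Γ ▸[μ] A) (wk μ A) (wk μ' A') Γ
| es_ext {n m} (Γ Δ : ctx m) (μ μ' : cell n m) A A' σ σ' M M' :
    eq_sub Γ σ σ' Δ -> μ ≈ μ' -> eq_ty large (Δ ◂ μ) A A' ->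
    eq_tm (Γ ◂ μ) M M' A⟦σ ◃ μ⟧ ->
    eq_sub Γ (ext μ A σ M) (ext μ' A' σ' M') (Δ ▸[μ] A)
| es_lock {n m} (Γ Δ : ctx m) (μ μ' : cell n m) σ σ' :
    eq_sub Γ σ σ' Δ -> μ ≈ μ' ->
    eq_sub (Γ ◂ μ) (σ ◃ μ) (σ' ◃ μ') (Δ ◂ μ)
| es_key {n m} (Γ : ctx m) (μ μ' ν ν' : cell n m) :
    wf_ctx Γ -> μ ≤ ν -> μ ≈ μ' -> ν ≈ ν' ->
    eq_sub (Γ ◂ ν) (key μ ν) (key μ' ν') (Γ ◂ μ)
| es_idl {m} (Γ Δ : ctx m) σ : wf_sub Γ σ Δ -> eq_sub Γ (id ⊙ σ) σ Δ
| es_idr {m} (Γ Δ : ctx m) σ : wf_sub Γ σ Δ -> eq_sub Γ (σ ⊙ id) σ Δ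
| es_assoc {m} (Γ Δ Ξ Θ : ctx m) σ τ ρ :
    wf_sub Γ ρ Δ -> wf_sub Δ τ Ξ -> wf_sub Ξ σ Θ ->
    eq_sub Γ ((σ ⊙ τ) ⊙ ρ) (σ ⊙ (τ ⊙ ρ)) Θ
| es_bang {m} (Γ : ctx m) σ : wf_sub Γ σ cemp -> eq_sub Γ σ bang cemp
| es_wk_ext {n m} (Γ Δ : ctx m) (μ : cell n m) A σ M :
    wf_sub Γ σ Δ -> wf_ty large (Δ ◂ μ) A -> wf_tm (Γ ◂ μ) M A⟦σ ◃ μ⟧ ->
    eq_sub Γ (wk μ A ⊙ ext μ A σ M) σ Δ
| es_ext_comp {n m} (Γ Δ Ξ : ctx m) (μ : cell n m) A σ M τ :
    wf_sub Γ τ Δ -> wf_sub Δ σ Ξ -> wf_ty large (Ξ ◂ μ) A ->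
    wf_tm (Δ ◂ μ) M A⟦σ ◃ μ⟧ ->
    eq_sub Γ (ext μ A σ M ⊙ τ) (ext μ A (σ ⊙ τ) M⦃τ ◃ μ⦄) (Ξ ▸[μ] A)
| es_ext_eta {n m} (Γ : ctx m) (μ : cell n m) A :
    wf_ctx (Γ ▸[μ] A) ->
    eq_sub (Γ ▸[μ] A) id (ext μ A (wk μ A) (var μ A)) (Γ ▸[μ] A)
| es_lock_id {n m} (Γ : ctx m) (μ : cell n m) :
    wf_ctx Γ -> eq_sub (Γ ◂ μ) (id ◃ μ) id (Γ ◂ μ)
| es_lock_comp {n m} (Γ Δ Ξ : ctx m) (μ : cell n m) σ τ :
    wf_sub Γ τ Δ -> wf_sub Δ σ Ξ ->
    eq_sub (Γ ◂ μ) ((σ ⊙ τ) ◃ μ) ((σ ◃ μ) ⊙ (τ ◃ μ)) (Ξ ◂ μ)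
| es_lock_one {m} (Γ Δ : ctx m) σ :
    wf_sub Γ σ Δ -> eq_sub Γ (σ ◃ one) σ Δ
| es_lock_cmp {o n m} (Γ Δ : ctx m) (μ : cell n m) (ν : cell o n) σ :
    wf_sub Γ σ Δ ->
    eq_sub (Γ ◂ μ ◂ ν) (σ ◃ μ ◃ ν) (σ ◃ (μ ∘ ν)) (Δ ◂ μ ◂ ν)
| es_key_nat {n m} (Γ Δ : ctx m) (μ ν : cell n m) σ :
    wf_sub Γ σ Δ -> μ ≤ ν ->
    eq_sub (Γ ◂ ν) (key μ ν ⊙ (σ ◃ ν)) ((σ ◃ μ) ⊙ key μ ν) (Δ ◂ μ)
| es_key_id {n m} (Γ : ctx m) (μ : cell n m) :
    wf_ctx Γ -> eq_sub (Γ ◂ μ) (key μ μ) id (Γ ◂ μ)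
| es_key_comp {n m} (Γ : ctx m) (μ ν ρ : cell n m) :
    wf_ctx Γ -> μ ≤ ν -> ν ≤ ρ ->
    eq_sub (Γ ◂ ρ) (key μ ν ⊙ key ν ρ) (key μ ρ) (Γ ◂ μ)
| es_key_hcomp {o n m} (Γ : ctx m) (μ μ' : cell n m) (ν ν' : cell o n) :
    wf_ctx Γ -> μ ≤ μ' -> ν ≤ ν' ->
    eq_sub (Γ ◂ μ' ◂ ν')
      (key ν ν' ⊙ (key μ μ' ◃ ν')) (key (μ ∘ ν) (μ' ∘ ν')) (Γ ◂ μ ◂ ν)

with wf_ty : forall {m}, size -> ctx m -> ty m -> Prop :=
| wt_conv {m} i (Γ Γ' : ctx m) A : wf_ty i Γ A -> eq_ctx Γ Γ' -> wf_ty i Γ' A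
| wt_lift {m} (Γ : ctx m) A : wf_ty small Γ A -> wf_ty large Γ A
| wt_sub {m} i (Γ Δ : ctx m) A σ :
    wf_sub Γ σ Δ -> wf_ty i Δ A -> wf_ty i Γ A⟦σ⟧
| wt_pi {m} i (Γ : ctx m) A B :
    wf_ty i Γ A -> wf_ty i (Γ ▸ A) B -> wf_ty i Γ (Pi A B)
| wt_sig {m} i (Γ : ctx m) A B :
    wf_ty i Γ A -> wf_ty i (Γ ▸ A) B -> wf_ty i Γ (Sig A B)
| wt_bool {m} i (Γ : ctx m) : wf_ctx Γ -> wf_ty i Γ Bool
| wt_eq {m} i (Γ : ctx m) A M N :
    wf_ty i Γ A -> wf_tm Γ M A -> wf_tm Γ N A -> wf_ty i Γ (Eq A M N)
| wt_U {m} (Γ : ctx m) : wf_ctx Γ -> wf_ty large Γ U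
| wt_El {m} (Γ : ctx m) M : wf_tm Γ M U -> wf_ty small Γ (El M)
| wt_modal {n m} i (Γ : ctx m) (μ : cell n m) A :
    wf_ty i (Γ ◂ μ) A -> wf_ty i Γ (Modal μ A)

with eq_ty : forall {m}, size -> ctx m -> ty m -> ty m -> Prop :=
| et_refl {m} i (Γ : ctx m) A : wf_ty i Γ A -> eq_ty i Γ A A
| et_sym {m} i (Γ : ctx m) A A' : eq_ty i Γ A A' -> eq_ty i Γ A' A
| et_trans {m} i (Γ : ctx m) A A' A'' :
    eq_ty i Γ A A' -> eq_ty i Γ A' A'' -> eq_ty i Γ A A''
| et_conv {m} i (Γ Γ' : ctx m) A A' :
    eq_ty i Γ A A' -> eq_ctx Γ Γ' -> eq_ty i Γ' A A'
| et_lift {m} (Γ : ctx m) A A' : eq_ty small Γ A A' -> eq_ty large Γ A A'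
| et_sub {m} i (Γ Δ : ctx m) A A' σ σ' :
    eq_sub Γ σ σ' Δ -> eq_ty i Δ A A' -> eq_ty i Γ A⟦σ⟧ A'⟦σ'⟧
| et_pi {m} i (Γ : ctx m) A A' B B' :
    eq_ty i Γ A A' -> eq_ty i (Γ ▸ A) B B' -> eq_ty i Γ (Pi A B) (Pi A' B')
| et_sig {m} i (Γ : ctx m) A A' B B' :
    eq_ty i Γ A A' -> eq_ty i (Γ ▸ A) B B' -> eq_ty i Γ (Sig A B) (Sig A' B')
| et_eq {m} i (Γ : ctx m) A A' M M' N N' :
    eq_ty i Γ A A' -> eq_tm Γ M M' A -> eq_tm Γ N N' A ->
    eq_ty i Γ (Eq A M N) (Eq A' M' N')
| et_El {m} (Γ : ctx m) M M' :
    eq_tm Γ M M' U -> eq_ty small Γ (El M) (El M')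
| et_modal {n m} i (Γ : ctx m) (μ μ' : cell n m) A A' :
    μ ≈ μ' -> eq_ty i (Γ ◂ μ) A A' -> eq_ty i Γ (Modal μ A) (Modal μ' A')
| et_id {m} i (Γ : ctx m) A : wf_ty i Γ A -> eq_ty i Γ A⟦id⟧ A
| et_comp {m} i (Γ Δ Ξ : ctx m) A σ τ :
    wf_sub Γ τ Δ -> wf_sub Δ σ Ξ -> wf_ty i Ξ A ->
    eq_ty i Γ A⟦σ ⊙ τ⟧ A⟦σ⟧⟦τ⟧
| et_pi_sub {m} i (Γ Δ : ctx m) A B σ :
    wf_sub Γ σ Δ -> wf_ty i Δ A -> wf_ty i (Δ ▸ A) B ->
    eq_ty i Γ (Pi A B)⟦σ⟧ (Pi A⟦σ⟧ B⟦up one A σ⟧)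
| et_sig_sub {m} i (Γ Δ : ctx m) A B σ :
    wf_sub Γ σ Δ -> wf_ty i Δ A -> wf_ty i (Δ ▸ A) B ->
    eq_ty i Γ (Sig A B)⟦σ⟧ (Sig A⟦σ⟧ B⟦up one A σ⟧)
| et_bool_sub {m} i (Γ Δ : ctx m) σ :
    wf_sub Γ σ Δ -> eq_ty i Γ Bool⟦σ⟧ Bool
| et_eq_sub {m} i (Γ Δ : ctx m) A M N σ :
    wf_sub Γ σ Δ -> wf_ty i Δ A -> wf_tm Δ M A -> wf_tm Δ N A ->
    eq_ty i Γ (Eq A M N)⟦σ⟧ (Eq A⟦σ⟧ M⦃σ⦄ N⦃σ⦄)
| et_U_sub {m} (Γ Δ : ctx m) σ : wf_sub Γ σ Δ -> eq_ty large Γ U⟦σ⟧ U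
| et_El_sub {m} (Γ Δ : ctx m) M σ :
    wf_sub Γ σ Δ -> wf_tm Δ M U -> eq_ty small Γ (El M)⟦σ⟧ (El M⦃σ⦄)
| et_modal_sub {n m} i (Γ Δ : ctx m) (μ : cell n m) A σ :
    wf_sub Γ σ Δ -> wf_ty i (Δ ◂ μ) A ->
    eq_ty i Γ (Modal μ A)⟦σ⟧ (Modal μ A⟦σ ◃ μ⟧)
| et_El_code {m} (Γ : ctx m) A :
    wf_ty small Γ A -> eq_ty small Γ (El (code A)) A

with wf_tm : forall {m}, ctx m -> tm m -> ty m -> Prop :=
| wm_conv {m} (Γ Γ' : ctx m) M A A' :
    wf_tm Γ M A -> eq_ctx Γ Γ' -> eq_ty large Γ A A' -> wf_tm Γ' M A'
| wm_sub {m} (Γ Δ : ctx m) M A σ :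
    wf_sub Γ σ Δ -> wf_tm Δ M A -> wf_tm Γ M⦃σ⦄ A⟦σ⟧
| wm_var {n m} (Γ : ctx m) (μ : cell n m) A :
    wf_ctx (Γ ▸[μ] A) -> wf_tm (Γ ▸[μ] A ◂ μ) (var μ A) A⟦wk μ A ◃ μ⟧
| wm_lam {m} (Γ : ctx m) A B M :
    wf_ty large Γ A -> wf_ty large (Γ ▸ A) B -> wf_tm (Γ ▸ A) M B ->
    wf_tm Γ (lam A B M) (Pi A B)
| wm_app {m} (Γ : ctx m) A B M N :
    wf_ty large Γ A -> wf_ty large (Γ ▸ A) B ->
    wf_tm Γ M (Pi A B) -> wf_tm Γ N A ->
    wf_tm Γ (app A B M N) B⟦inst one A N⟧
| wm_pair {m} (Γ : ctx m) A B M N :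
    wf_ty large Γ A -> wf_ty large (Γ ▸ A) B ->
    wf_tm Γ M A -> wf_tm Γ N B⟦inst one A M⟧ ->
    wf_tm Γ (pair A B M N) (Sig A B)
| wm_fst {m} (Γ : ctx m) A B M :
    wf_ty large Γ A -> wf_ty large (Γ ▸ A) B -> wf_tm Γ M (Sig A B) ->
    wf_tm Γ (fst A B M) A
| wm_snd {m} (Γ : ctx m) A B M :
    wf_ty large Γ A -> wf_ty large (Γ ▸ A) B -> wf_tm Γ M (Sig A B) ->
    wf_tm Γ (snd A B M) B⟦inst one A (fst A B M)⟧
| wm_tt {m} (Γ : ctx m) : wf_ctx Γ -> wf_tm Γ tt Bool
| wm_ff {m} (Γ : ctx m) : wf_ctx Γ -> wf_tm Γ ff Bool
| wm_bif {m} (Γ : ctx m) C M0 M1 N :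
    wf_ty large (Γ ▸ Bool) C ->
    wf_tm Γ M0 C⟦inst one Bool tt⟧ -> wf_tm Γ M1 C⟦inst one Bool ff⟧ ->
    wf_tm Γ N Bool -> wf_tm Γ (bif C M0 M1 N) C⟦inst one Bool N⟧
| wm_refl {m} (Γ : ctx m) A M : wf_tm Γ M A -> wf_tm Γ (refl A M) (Eq A M M)
| wm_code {m} (Γ : ctx m) A : wf_ty small Γ A -> wf_tm Γ (code A) U
| wm_mod {n m} (Γ : ctx m) (μ : cell n m) A M :
    wf_tm (Γ ◂ μ) M A -> wf_tm Γ (mod μ A M) (Modal μ A)
| wm_let {n m o} (Γ : ctx o) (ν : cell m o) (μ : cell n m) A B M0 M1 :
    wf_ty large (Γ ◂ ν ◂ μ) A ->
    wf_ty large (Γ ▸[ν] Modal μ A) B ->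
    wf_tm (Γ ◂ ν) M0 (Modal μ A) ->
    wf_tm (Γ ▸[ν ∘ μ] A) M1 B⟦modsub ν μ A⟧ ->
    wf_tm Γ (letmod ν μ A B M0 M1) B⟦inst ν (Modal μ A) M0⟧
| wm_löb (Γ : ctx t) A :
    wf_ty large Γ A -> wf_tm Γ (löb A) (arr (arr (later A) A) A)

with eq_tm : forall {m}, ctx m -> tm m -> tm m -> ty m -> Prop :=
| em_refl {m} (Γ : ctx m) M A : wf_tm Γ M A -> eq_tm Γ M M A
| em_sym {m} (Γ : ctx m) M M' A : eq_tm Γ M M' A -> eq_tm Γ M' M A
| em_trans {m} (Γ : ctx m) M M' M'' A :
    eq_tm Γ M M' A -> eq_tm Γ M' M'' A -> eq_tm Γ M M'' A
| em_conv {m} (Γ Γ' : ctx m) M M' A A' :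
    eq_tm Γ M M' A -> eq_ctx Γ Γ' -> eq_ty large Γ A A' -> eq_tm Γ' M M' A'
| em_sub {m} (Γ Δ : ctx m) M M' A σ σ' :
    eq_sub Γ σ σ' Δ -> eq_tm Δ M M' A -> eq_tm Γ M⦃σ⦄ M'⦃σ'⦄ A⟦σ⟧
| em_var {n m} (Γ : ctx m) (μ μ' : cell n m) A A' :
    wf_ctx Γ -> μ ≈ μ' -> eq_ty large (Γ ◂ μ) A A' ->
    eq_tm (Γ ▸[μ] A ◂ μ) (var μ A) (var μ' A') A⟦wk μ A ◃ μ⟧
| em_lam {m} (Γ : ctx m) A A' B B' M M' :
    eq_ty large Γ A A' -> eq_ty large (Γ ▸ A) B B' -> eq_tm (Γ ▸ A) M M' B ->
    eq_tm Γ (lam A B M) (lam A' B' M') (Pi A B)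
| em_app {m} (Γ : ctx m) A A' B B' M M' N N' :
    eq_ty large Γ A A' -> eq_ty large (Γ ▸ A) B B' ->
    eq_tm Γ M M' (Pi A B) -> eq_tm Γ N N' A ->
    eq_tm Γ (app A B M N) (app A' B' M' N') B⟦inst one A N⟧
| em_pair {m} (Γ : ctx m) A A' B B' M M' N N' :
    eq_ty large Γ A A' -> eq_ty large (Γ ▸ A) B B' ->
    eq_tm Γ M M' A -> eq_tm Γ N N' B⟦inst one A M⟧ ->
    eq_tm Γ (pair A B M N) (pair A' B' M' N') (Sig A B)
| em_fst {m} (Γ : ctx m) A A' B B' M M' :
    eq_ty large Γ A A' -> eq_ty large (Γ ▸ A) B B' -> eq_tm Γ M M' (Sig A B) ->
    eq_tm Γ (fst A B M) (fst A' B' M') A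
| em_snd {m} (Γ : ctx m) A A' B B' M M' :
    eq_ty large Γ A A' -> eq_ty large (Γ ▸ A) B B' -> eq_tm Γ M M' (Sig A B) ->
    eq_tm Γ (snd A B M) (snd A' B' M') B⟦inst one A (fst A B M)⟧
| em_bif {m} (Γ : ctx m) C C' M0 M0' M1 M1' N N' :
    eq_ty large (Γ ▸ Bool) C C' ->
    eq_tm Γ M0 M0' C⟦inst one Bool tt⟧ -> eq_tm Γ M1 M1' C⟦inst one Bool ff⟧ ->
    eq_tm Γ N N' Bool ->
    eq_tm Γ (bif C M0 M1 N) (bif C' M0' M1' N') C⟦inst one Bool N⟧
| em_refl_cong {m} (Γ : ctx m) A A' M M' :
    eq_ty large Γ A A' -> eq_tm Γ M M' A ->
    eq_tm Γ (refl A M) (refl A' M') (Eq A M M)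
| em_code {m} (Γ : ctx m) A A' :
    eq_ty small Γ A A' -> eq_tm Γ (code A) (code A') U
| em_mod {n m} (Γ : ctx m) (μ μ' : cell n m) A A' M M' :
    μ ≈ μ' -> eq_ty large (Γ ◂ μ) A A' -> eq_tm (Γ ◂ μ) M M' A ->
    eq_tm Γ (mod μ A M) (mod μ' A' M') (Modal μ A)
| em_let {n m o} (Γ : ctx o) (ν ν' : cell m o) (μ μ' : cell n m)
    A A' B B' M0 M0' M1 M1' :
    ν ≈ ν' -> μ ≈ μ' ->
    eq_ty large (Γ ◂ ν ◂ μ) A A' ->
    eq_ty large (Γ ▸[ν] Modal μ A) B B' ->
    eq_tm (Γ ◂ ν) M0 M0' (Modal μ A) ->
    eq_tm (Γ ▸[ν ∘ μ] A) M1 M1' B⟦modsub ν μ A⟧ ->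
    eq_tm Γ (letmod ν μ A B M0 M1) (letmod ν' μ' A' B' M0' M1')
      B⟦inst ν (Modal μ A) M0⟧
| em_löb (Γ : ctx t) A A' :
    eq_ty large Γ A A' -> eq_tm Γ (löb A) (löb A') (arr (arr (later A) A) A)
| em_id {m} (Γ : ctx m) M A : wf_tm Γ M A -> eq_tm Γ M⦃id⦄ M A
| em_comp {m} (Γ Δ Ξ : ctx m) M A σ τ :
    wf_sub Γ τ Δ -> wf_sub Δ σ Ξ -> wf_tm Ξ M A ->
    eq_tm Γ M⦃σ ⊙ τ⦄ M⦃σ⦄⦃τ⦄ A⟦σ ⊙ τ⟧
| em_var_ext {n m} (Γ Δ : ctx m) (μ : cell n m) A σ M :
    wf_sub Γ σ Δ -> wf_ty large (Δ ◂ μ) A -> wf_tm (Γ ◂ μ) M A⟦σ ◃ μ⟧ ->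
    eq_tm (Γ ◂ μ) (var μ A)⦃ext μ A σ M ◃ μ⦄ M A⟦σ ◃ μ⟧
| em_lam_sub {m} (Γ Δ : ctx m) A B M σ :
    wf_sub Γ σ Δ ->
    wf_ty large Δ A -> wf_ty large (Δ ▸ A) B -> wf_tm (Δ ▸ A) M B ->
    eq_tm Γ (lam A B M)⦃σ⦄ (lam A⟦σ⟧ B⟦up one A σ⟧ M⦃up one A σ⦄)
      (Pi A B)⟦σ⟧
| em_app_sub {m} (Γ Δ : ctx m) A B M N σ :
    wf_sub Γ σ Δ ->
    wf_ty large Δ A -> wf_ty large (Δ ▸ A) B ->
    wf_tm Δ M (Pi A B) -> wf_tm Δ N A ->
    eq_tm Γ (app A B M N)⦃σ⦄ (app A⟦σ⟧ B⟦up one A σ⟧ M⦃σ⦄ N⦃σ⦄)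
      B⟦inst one A N⟧⟦σ⟧
| em_pair_sub {m} (Γ Δ : ctx m) A B M N σ :
    wf_sub Γ σ Δ ->
    wf_ty large Δ A -> wf_ty large (Δ ▸ A) B ->
    wf_tm Δ M A -> wf_tm Δ N B⟦inst one A M⟧ ->
    eq_tm Γ (pair A B M N)⦃σ⦄ (pair A⟦σ⟧ B⟦up one A σ⟧ M⦃σ⦄ N⦃σ⦄)
      (Sig A B)⟦σ⟧
| em_fst_sub {m} (Γ Δ : ctx m) A B M σ :
    wf_sub Γ σ Δ ->
    wf_ty large Δ A -> wf_ty large (Δ ▸ A) B -> wf_tm Δ M (Sig A B) ->
    eq_tm Γ (fst A B M)⦃σ⦄ (fst A⟦σ⟧ B⟦up one A σ⟧ M⦃σ⦄) A⟦σ⟧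
| em_snd_sub {m} (Γ Δ : ctx m) A B M σ :
    wf_sub Γ σ Δ ->
    wf_ty large Δ A -> wf_ty large (Δ ▸ A) B -> wf_tm Δ M (Sig A B) ->
    eq_tm Γ (snd A B M)⦃σ⦄ (snd A⟦σ⟧ B⟦up one A σ⟧ M⦃σ⦄)
      B⟦inst one A (fst A B M)⟧⟦σ⟧
| em_tt_sub {m} (Γ Δ : ctx m) σ : wf_sub Γ σ Δ -> eq_tm Γ tt⦃σ⦄ tt Bool
| em_ff_sub {m} (Γ Δ : ctx m) σ : wf_sub Γ σ Δ -> eq_tm Γ ff⦃σ⦄ ff Bool
| em_bif_sub {m} (Γ Δ : ctx m) C M0 M1 N σ :
    wf_sub Γ σ Δ ->
    wf_ty large (Δ ▸ Bool) C ->
    wf_tm Δ M0 C⟦inst one Bool tt⟧ -> wf_tm Δ M1 C⟦inst one Bool ff⟧ ->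
    wf_tm Δ N Bool ->
    eq_tm Γ (bif C M0 M1 N)⦃σ⦄ (bif C⟦up one Bool σ⟧ M0⦃σ⦄ M1⦃σ⦄ N⦃σ⦄)
      C⟦inst one Bool N⟧⟦σ⟧
| em_refl_sub {m} (Γ Δ : ctx m) A M σ :
    wf_sub Γ σ Δ -> wf_tm Δ M A ->
    eq_tm Γ (refl A M)⦃σ⦄ (refl A⟦σ⟧ M⦃σ⦄) (Eq A M M)⟦σ⟧
| em_code_sub {m} (Γ Δ : ctx m) A σ :
    wf_sub Γ σ Δ -> wf_ty small Δ A -> eq_tm Γ (code A)⦃σ⦄ (code A⟦σ⟧) U
| em_mod_sub {n m} (Γ Δ : ctx m) (μ : cell n m) A M σ :
    wf_sub Γ σ Δ -> wf_tm (Δ ◂ μ) M A ->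
    eq_tm Γ (mod μ A M)⦃σ⦄ (mod μ A⟦σ ◃ μ⟧ M⦃σ ◃ μ⦄) (Modal μ A)⟦σ⟧
| em_let_sub {n m o} (Γ Δ : ctx o) (ν : cell m o) (μ : cell n m) A B M0 M1 σ :
    wf_sub Γ σ Δ ->
    wf_ty large (Δ ◂ ν ◂ μ) A ->
    wf_ty large (Δ ▸[ν] Modal μ A) B ->
    wf_tm (Δ ◂ ν) M0 (Modal μ A) ->
    wf_tm (Δ ▸[ν ∘ μ] A) M1 B⟦modsub ν μ A⟧ ->
    eq_tm Γ (letmod ν μ A B M0 M1)⦃σ⦄
      (letmod ν μ A⟦σ ◃ ν ◃ μ⟧ B⟦up ν (Modal μ A) σ⟧
         M0⦃σ ◃ ν⦄ M1⦃up (ν ∘ μ) A σ⦄)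
      B⟦inst ν (Modal μ A) M0⟧⟦σ⟧
| em_löb_sub (Γ Δ : ctx t) A σ :
    wf_sub Γ σ Δ -> wf_ty large Δ A ->
    eq_tm Γ (löb A)⦃σ⦄ (löb A⟦σ⟧) (arr (arr (later A) A) A)⟦σ⟧
| em_pi_beta {m} (Γ : ctx m) A B M N :
    wf_ty large Γ A -> wf_ty large (Γ ▸ A) B ->
    wf_tm (Γ ▸ A) M B -> wf_tm Γ N A ->
    eq_tm Γ (app A B (lam A B M) N) M⦃inst one A N⦄ B⟦inst one A N⟧
| em_pi_eta {m} (Γ : ctx m) A B M :
    wf_ty large Γ A -> wf_ty large (Γ ▸ A) B -> wf_tm Γ M (Pi A B) ->
    eq_tm Γ M
      (lam A B (app A⟦wk one A⟧ B⟦up one A (wk one A)⟧ M⦃wk one A⦄ (var one A)))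
      (Pi A B)
| em_fst_beta {m} (Γ : ctx m) A B M N :
    wf_ty large Γ A -> wf_ty large (Γ ▸ A) B ->
    wf_tm Γ M A -> wf_tm Γ N B⟦inst one A M⟧ ->
    eq_tm Γ (fst A B (pair A B M N)) M A
| em_snd_beta {m} (Γ : ctx m) A B M N :
    wf_ty large Γ A -> wf_ty large (Γ ▸ A) B ->
    wf_tm Γ M A -> wf_tm Γ N B⟦inst one A M⟧ ->
    eq_tm Γ (snd A B (pair A B M N)) N B⟦inst one A M⟧
| em_sig_eta {m} (Γ : ctx m) A B M :
    wf_ty large Γ A -> wf_ty large (Γ ▸ A) B -> wf_tm Γ M (Sig A B) ->
    eq_tm Γ M (pair A B (fst A B M) (snd A B M)) (Sig A B)
| em_bif_tt {m} (Γ : ctx m) C M0 M1 :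
    wf_ty large (Γ ▸ Bool) C ->
    wf_tm Γ M0 C⟦inst one Bool tt⟧ -> wf_tm Γ M1 C⟦inst one Bool ff⟧ ->
    eq_tm Γ (bif C M0 M1 tt) M0 C⟦inst one Bool tt⟧
| em_bif_ff {m} (Γ : ctx m) C M0 M1 :
    wf_ty large (Γ ▸ Bool) C ->
    wf_tm Γ M0 C⟦inst one Bool tt⟧ -> wf_tm Γ M1 C⟦inst one Bool ff⟧ ->
    eq_tm Γ (bif C M0 M1 ff) M1 C⟦inst one Bool ff⟧
| em_code_El {m} (Γ : ctx m) M : wf_tm Γ M U -> eq_tm Γ (code (El M)) M U
| em_let_beta {n m o} (Γ : ctx o) (ν : cell m o) (μ : cell n m) A B N M1 :
    wf_ty large (Γ ▸[ν] Modal μ A) B ->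
    wf_tm (Γ ◂ ν ◂ μ) N A ->
    wf_tm (Γ ▸[ν ∘ μ] A) M1 B⟦modsub ν μ A⟧ ->
    eq_tm Γ (letmod ν μ A B (mod μ A N) M1) M1⦃inst (ν ∘ μ) A N⦄
      B⟦inst ν (Modal μ A) (mod μ A N)⟧
| em_reflection {m} (Γ : ctx m) A M N P :
    wf_ty large Γ A -> wf_tm Γ M A -> wf_tm Γ N A ->
    wf_tm Γ P (Eq A M N) -> eq_tm Γ M N A
| em_löb_unfold (Γ : ctx t) A M :
    wf_ty large Γ A -> wf_tm Γ M (arr (later A) A) ->
    eq_tm Γ (löb_at A M) (ap (later A) A M (next A (löb_at A M))) A.

(** For A at mode t and f : ▷A → A over Γ, the type
    (x : A) → Eq_A(f(next(x)), x) → Eq_A(löb(f), x). *)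
Definition löb_unique (A : ty t) (f : tm t) : ty t :=
  let w := wk one A in
  let A' := A⟦w⟧ in
  let f' := f⦃w⦄ in
  let x := var one A in
  Pi A (arr (Eq A' (ap (later A') A' f' (next A' x)) x)
            (Eq A' (löb_at A' f') x)).

(* Main.v *)
(** Two guarded fixed points N, N' of f are equal by Löb induction on Eq N N':
    under ▷, the induction hypothesis and equality reflection identify
    N^{1≤ℓ} with N'^{1≤ℓ}.  As next N computes to mod_ℓ(N^{1≤ℓ}), this gives
    next N = next N', so that N = f(next N) = f(next N') = N'. *)
Require Import Defs.

(** * Units of the mode theory *)

Lemma cell_eq_refl {n m} (μ : cell n m) : μ ≈ μ.
Proof. split; apply le_refl. Qed.

Lemma one_cmp {n m} (μ : cell n m) : one ∘ μ ≈ μ.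
Proof. split; [apply le_idl | apply ge_idl]. Qed.

Lemma one_one : @one t ∘ one ≈ one.
Proof. apply one_cmp. Qed.

(** 1-cells are raw representatives, so [one ∘ one], the modality of the variable bound in [next],
    is equivalent to [one] without being syntactically [one]. This is why a general [κ ≈ one] is
    treated here and below. *)
Lemma eq_ctx_unit {m} (Γ : ctx m) (κ : cell m m) :
  wf_ctx Γ -> κ ≈ one -> eq_ctx (Γ ◂ κ) Γ.
Proof.
  intros hΓ hκ. apply ec_trans with (Γ ◂ one); [|now apply ec_one].
  apply ec_clock; [now apply ec_refl | exact hκ].
Qed.

Lemma wf_ty_unit {m} i (Γ : ctx m) (κ : cell m m) A :
  wf_ctx Γ -> κ ≈ one -> wf_ty i Γ A -> wf_ty i (Γ ◂ κ) A.
Proof.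
  intros hΓ hκ hA. apply wt_conv with Γ; [exact hA|].
  apply ec_sym. now apply eq_ctx_unit.
Qed.

Lemma wf_ctx_ext {m} (Γ : ctx m) A :
  wf_ctx Γ -> wf_ty large Γ A -> wf_ctx (Γ ▸ A).
Proof.
  intros. apply wf_cext; [assumption|].
  apply wf_ty_unit; auto using cell_eq_refl.
Qed.

Lemma lock_unit {m} (Γ Δ : ctx m) (κ : cell m m) σ :
  wf_ctx Γ -> wf_ctx Δ -> κ ≈ one -> wf_sub Γ σ Δ ->
  eq_sub Γ (σ ◃ κ) σ Δ.
Proof.
  intros hΓ hΔ hκ hσ. apply es_trans with (σ ◃ one); [|now apply es_lock_one].
  apply es_conv with (Γ ◂ κ) (Δ ◂ κ); try now apply eq_ctx_unit.
  apply es_lock; [now apply es_refl | exact hκ].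
Qed.

(** * Derived rules for substitution *)

Lemma wf_tm_eq {m} (Γ : ctx m) M A A' :
  wf_ctx Γ -> wf_tm Γ M A -> eq_ty large Γ A A' -> wf_tm Γ M A'.
Proof. intros. eapply wm_conv; eauto. now apply ec_refl. Qed.

Lemma eq_tm_eq {m} (Γ : ctx m) M M' A A' :
  wf_ctx Γ -> eq_tm Γ M M' A -> eq_ty large Γ A A' -> eq_tm Γ M M' A'.
Proof. intros. eapply em_conv; eauto. now apply ec_refl. Qed.

Lemma eq_ty_subst {m} i (Γ Δ : ctx m) A σ σ' :
  eq_sub Γ σ σ' Δ -> wf_ty i Δ A -> eq_ty i Γ A⟦σ⟧ A⟦σ'⟧.
Proof. intros. eapply et_sub; eauto. now apply et_refl. Qed.

Lemma eq_ty_comp {m} i (Γ Δ Ξ : ctx m) A σ τ ρ :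
  wf_sub Γ τ Δ -> wf_sub Δ σ Ξ -> wf_ty i Ξ A ->
  eq_sub Γ (σ ⊙ τ) ρ Ξ -> eq_ty i Γ A⟦σ⟧⟦τ⟧ A⟦ρ⟧.
Proof.
  intros. apply et_trans with (A⟦σ ⊙ τ⟧).
  - apply et_sym. eapply et_comp; eauto.
  - eapply eq_ty_subst; eauto.
Qed.

Lemma eq_ty_comp_id {m} i (Γ Δ : ctx m) A σ τ :
  wf_sub Γ τ Δ -> wf_sub Δ σ Γ -> wf_ty i Γ A ->
  eq_sub Γ (σ ⊙ τ) id Γ -> eq_ty i Γ A⟦σ⟧⟦τ⟧ A.
Proof.
  intros. apply et_trans with A⟦id⟧; [|now apply et_id].
  eapply eq_ty_comp; eauto.
Qed.

(** Explicit substitutions compose only up to judgmental equality, so a commuting square is brought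
    to types by passing through the composites. Typical squares are naturality of keys and weakening
    against lifting. *)
Lemma eq_ty_square {m} i (Γ Δ Δ' Ξ : ctx m) A σ τ σ' τ' :
  wf_sub Γ τ Δ -> wf_sub Δ σ Ξ -> wf_sub Γ τ' Δ' -> wf_sub Δ' σ' Ξ ->
  wf_ty i Ξ A -> eq_sub Γ (σ ⊙ τ) (σ' ⊙ τ') Ξ ->
  eq_ty i Γ A⟦σ⟧⟦τ⟧ A⟦σ'⟧⟦τ'⟧.
Proof.
  intros. apply et_trans with (A⟦σ' ⊙ τ'⟧).
  - eapply eq_ty_comp; eauto.
  - eapply et_comp; eauto.
Qed.

Lemma eq_tm_square {m} (Γ Δ Δ' Ξ : ctx m) M A σ τ σ' τ' :
  wf_ctx Γ ->
  wf_sub Γ τ Δ -> wf_sub Δ σ Ξ -> wf_sub Γ τ' Δ' -> wf_sub Δ' σ' Ξ ->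
  wf_ty large Ξ A -> wf_tm Ξ M A -> eq_sub Γ (σ ⊙ τ) (σ' ⊙ τ') Ξ ->
  eq_tm Γ M⦃σ⦄⦃τ⦄ M⦃σ'⦄⦃τ'⦄ A⟦σ⟧⟦τ⟧.
Proof.
  intros. apply eq_tm_eq with (A⟦σ ⊙ τ⟧); [assumption| |eapply et_comp; eauto].
  apply em_trans with (M⦃σ ⊙ τ⦄); [apply em_sym; eapply em_comp; eauto|].
  apply em_trans with (M⦃σ' ⊙ τ'⦄).
  - eapply em_sub; eauto. now apply em_refl.
  - apply eq_tm_eq with (A⟦σ' ⊙ τ'⟧); [assumption| |].
    + eapply em_comp; eauto.
    + eapply eq_ty_subst; eauto. now apply es_sym.
Qed.

Lemma wf_inst {n m} (Γ : ctx m) (μ : cell n m) A M :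
  wf_ctx Γ -> wf_ty large (Γ ◂ μ) A -> wf_tm (Γ ◂ μ) M A ->
  wf_sub Γ (inst μ A M) (Γ ▸[μ] A).
Proof.
  intros. apply ws_ext; [now apply ws_id | assumption |].
  (* [ws_ext] asks for the term at type [A⟦id ◃ μ⟧]; a locked identity is the identity. *)
  apply wf_tm_eq with A; [now apply wf_clock | assumption |].
  apply et_sym. apply et_trans with A⟦id⟧; [|now apply et_id].
  eapply eq_ty_subst; eauto. now apply es_lock_id.
Qed.

Lemma wk_inst {n m} (Γ : ctx m) (μ : cell n m) A M :
  wf_ctx Γ -> wf_ty large (Γ ◂ μ) A -> wf_tm (Γ ◂ μ) M A ->
  eq_sub Γ (wk μ A ⊙ inst μ A M) id Γ.
Proof.
  intros. apply es_wk_ext; [now apply ws_id | assumption |].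
  apply wf_tm_eq with A; [now apply wf_clock | assumption |].
  apply et_sym. apply et_trans with A⟦id⟧; [|now apply et_id].
  eapply eq_ty_subst; eauto. now apply es_lock_id.
Qed.

(** * Lifting a substitution under a modal binder *)

Section Up.
Context {n m} (Γ Δ : ctx m) (μ : cell n m) (A : ty n) (σ : sub m).
Hypotheses (hΓ : wf_ctx Γ) (hA : wf_ty large (Δ ◂ μ) A) (hσ : wf_sub Γ σ Δ).

Lemma wf_ctx_up : wf_ctx (Γ ▸[μ] A⟦σ ◃ μ⟧).
Proof.
  apply wf_cext; [assumption|].
  eapply wt_sub; eauto. now apply ws_lock.
Qed.

Lemma wf_var_up :
  wf_tm (Γ ▸[μ] A⟦σ ◃ μ⟧ ◂ μ) (var μ A⟦σ ◃ μ⟧)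
    A⟦(σ ⊙ wk μ A⟦σ ◃ μ⟧) ◃ μ⟧.
Proof.
  eapply wf_tm_eq; [apply wf_clock, wf_ctx_up | apply wm_var, wf_ctx_up |].
  eapply eq_ty_comp; eauto.
  - apply ws_lock, ws_wk, wf_ctx_up.
  - now apply ws_lock.
  - apply es_sym. eapply es_lock_comp; eauto. apply ws_wk, wf_ctx_up.
Qed.

Lemma wf_sub_comp_wk : wf_sub (Γ ▸[μ] A⟦σ ◃ μ⟧) (σ ⊙ wk μ A⟦σ ◃ μ⟧) Δ.
Proof. eapply ws_comp; eauto. apply ws_wk, wf_ctx_up. Qed.

Lemma wf_up : wf_sub (Γ ▸[μ] A⟦σ ◃ μ⟧) (up μ A σ) (Δ ▸[μ] A).
Proof. apply ws_ext; auto using wf_var_up, wf_sub_comp_wk. Qed.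

Lemma wk_up :
  eq_sub (Γ ▸[μ] A⟦σ ◃ μ⟧) (wk μ A ⊙ up μ A σ) (σ ⊙ wk μ A⟦σ ◃ μ⟧) Δ.
Proof. apply es_wk_ext; auto using wf_var_up, wf_sub_comp_wk. Qed.
End Up.

(** * Binders at the identity modality *)

Lemma wf_wk_one {m} (Γ : ctx m) A :
  wf_ctx Γ -> wf_ty large Γ A -> wf_sub (Γ ▸ A) (wk one A) Γ.
Proof. intros. apply ws_wk. now apply wf_ctx_ext. Qed.

Lemma wf_ty_wk_one {m} (Γ : ctx m) A B :
  wf_ctx Γ -> wf_ty large Γ A -> wf_ty large Γ B ->
  wf_ty large (Γ ▸ A) B⟦wk one A⟧.
Proof. intros. eapply wt_sub; eauto. now apply wf_wk_one. Qed.

Lemma wf_tm_one {m} (Γ : ctx m) M A :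
  wf_ctx Γ -> wf_tm Γ M A -> wf_ty large Γ A -> wf_tm (Γ ◂ one) M A.
Proof.
  intros. eapply wm_conv; eauto; [apply ec_sym; now apply ec_one|].
  now apply et_refl.
Qed.

Lemma wf_inst_one {m} (Γ : ctx m) A M :
  wf_ctx Γ -> wf_ty large Γ A -> wf_tm Γ M A ->
  wf_sub Γ (inst one A M) (Γ ▸ A).
Proof.
  intros. apply wf_inst; auto using wf_tm_one, wf_ty_unit, cell_eq_refl.
Qed.

Lemma wk_inst_one {m} (Γ : ctx m) A M :
  wf_ctx Γ -> wf_ty large Γ A -> wf_tm Γ M A ->
  eq_sub Γ (wk one A ⊙ inst one A M) id Γ.
Proof.
  intros. apply wk_inst; auto using wf_tm_one, wf_ty_unit, cell_eq_refl.
Qed.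

(** [up one A σ] is annotated with [A⟦σ ◃ one⟧], whereas the substitution law for [Pi] binds a
    variable of type [A⟦σ⟧]. The mismatch is removed here once, for the lifting lemmas that
    follow. *)
Lemma eq_ctx_up_one {m} (Γ Δ : ctx m) A σ :
  wf_ctx Γ -> wf_ctx Δ -> wf_ty large Δ A -> wf_sub Γ σ Δ ->
  eq_ctx (Γ ▸ A⟦σ ◃ one⟧) (Γ ▸ A⟦σ⟧).
Proof.
  intros. apply ec_cext; auto using cell_eq_refl, ec_refl.
  eapply et_conv; [|apply ec_sym; now apply ec_one].
  eapply eq_ty_subst; eauto. now apply es_lock_one.
Qed.

Lemma eq_wk_up_one {m} (Γ Δ : ctx m) A σ :
  wf_ctx Γ -> wf_ctx Δ -> wf_ty large Δ A -> wf_sub Γ σ Δ ->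
  eq_sub (Γ ▸ A⟦σ⟧) (wk one A⟦σ ◃ one⟧) (wk one A⟦σ⟧) Γ.
Proof.
  intros. eapply es_conv; [|eapply eq_ctx_up_one; eauto|now apply ec_refl].
  apply es_wk; auto using cell_eq_refl.
  eapply et_conv; [|apply ec_sym; now apply ec_one].
  eapply eq_ty_subst; eauto. now apply es_lock_one.
Qed.

Lemma wf_up_one {m} (Γ Δ : ctx m) A σ :
  wf_ctx Γ -> wf_ctx Δ -> wf_ty large Δ A -> wf_sub Γ σ Δ ->
  wf_sub (Γ ▸ A⟦σ⟧) (up one A σ) (Δ ▸ A).
Proof.
  intros. eapply ws_conv;
    [|eapply eq_ctx_up_one; eauto|apply ec_refl; now apply wf_ctx_ext].
  apply wf_up; auto using wf_ty_unit, cell_eq_refl.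
Qed.

Lemma wk_up_one {m} (Γ Δ : ctx m) A σ :
  wf_ctx Γ -> wf_ctx Δ -> wf_ty large Δ A -> wf_sub Γ σ Δ ->
  eq_sub (Γ ▸ A⟦σ⟧) (wk one A ⊙ up one A σ) (σ ⊙ wk one A⟦σ⟧) Δ.
Proof.
  intros. apply es_trans with (σ ⊙ wk one A⟦σ ◃ one⟧).
  - eapply es_conv; [|eapply eq_ctx_up_one; eauto|now apply ec_refl].
    apply wk_up; auto using wf_ty_unit, cell_eq_refl.
  - eapply es_comp; [|apply es_refl; eauto]. eapply eq_wk_up_one; eauto.
Qed.

Lemma wf_var_one {m} (Γ : ctx m) A :
  wf_ctx Γ -> wf_ty large Γ A -> wf_tm (Γ ▸ A) (var one A) A⟦wk one A⟧.
Proof.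
  intros. eapply wm_conv; [apply (wm_var Γ one A); now apply wf_ctx_ext | |].
  - apply ec_one; now apply wf_ctx_ext.
  - eapply et_conv; [|apply ec_sym, ec_one; now apply wf_ctx_ext].
    eapply eq_ty_subst; eauto. apply es_lock_one. now apply wf_wk_one.
Qed.

(** * Functions *)

Lemma wf_arr {m} (Γ : ctx m) A B :
  wf_ctx Γ -> wf_ty large Γ A -> wf_ty large Γ B -> wf_ty large Γ (arr A B).
Proof. intros. apply wt_pi; auto using wf_ty_wk_one. Qed.

(** The codomain does not depend on the bound variable, so lifting [σ] and then weakening amounts to
    weakening and then [σ]. The domain is left as any [A'] equal to [A⟦σ⟧], so that [(later A)⟦σ⟧]
    can be traded for [later A⟦σ⟧] in the same step. *)
Lemma eq_arr_sub {m} (Γ Δ : ctx m) A B A' σ :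
  wf_ctx Γ -> wf_ctx Δ -> wf_ty large Δ A -> wf_ty large Δ B ->
  wf_sub Γ σ Δ -> wf_ty large Γ A' -> eq_ty large Γ A⟦σ⟧ A' ->
  eq_ty large Γ (arr A B)⟦σ⟧ (arr A' B⟦σ⟧).
Proof.
  intros. assert (wf_ty large Γ A⟦σ⟧) by (eapply wt_sub; eauto).
  eapply et_trans; [eapply et_pi_sub; eauto using wf_ty_wk_one|].
  apply et_pi; [assumption|].
  eapply eq_ty_square; eauto using wf_up_one, wf_wk_one.
  - apply (ws_conv (Γ ▸ A') _ Γ Γ); [now apply wf_wk_one | | now apply ec_refl].
    apply ec_sym, ec_cext; auto using ec_refl, cell_eq_refl.
    eapply et_conv; eauto. apply ec_sym. now apply ec_one.
  - eapply es_trans; [eapply wk_up_one; eauto|].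
    eapply es_comp; [|apply es_refl; eassumption].
    apply es_wk; auto using cell_eq_refl.
    eapply et_conv; eauto. apply ec_sym. now apply ec_one.
Qed.

Lemma eq_ty_wk_inst {m} (Γ : ctx m) A B N :
  wf_ctx Γ -> wf_ty large Γ A -> wf_ty large Γ B -> wf_tm Γ N A ->
  eq_ty large Γ B⟦wk one A⟧⟦inst one A N⟧ B.
Proof.
  intros. eapply eq_ty_comp_id;
    eauto using wf_inst_one, wf_wk_one, wk_inst_one.
Qed.

Lemma wf_ap {m} (Γ : ctx m) A B M N :
  wf_ctx Γ -> wf_ty large Γ A -> wf_ty large Γ B ->
  wf_tm Γ M (arr A B) -> wf_tm Γ N A -> wf_tm Γ (ap A B M N) B.
Proof.
  intros. apply wf_tm_eq with B⟦wk one A⟧⟦inst one A N⟧;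
    [assumption | |now apply eq_ty_wk_inst].
  apply wm_app; auto using wf_ty_wk_one.
Qed.

(** Needed because the two arguments are identified only after [σ], where an induction hypothesis is
    in scope. Both applications are first pushed through [σ], and congruence is applied there. *)
Lemma eq_ap_sub {m} (Γ Δ : ctx m) A B M N N' σ :
  wf_ctx Γ -> wf_ctx Δ -> wf_ty large Δ A -> wf_ty large Δ B ->
  wf_sub Γ σ Δ -> wf_tm Δ M (arr A B) -> wf_tm Δ N A -> wf_tm Δ N' A ->
  eq_tm Γ N⦃σ⦄ N'⦃σ⦄ A⟦σ⟧ ->
  eq_tm Γ (ap A B M N)⦃σ⦄ (ap A B M N')⦃σ⦄ B⟦σ⟧.
Proof.
  intros hΓ hΔ hA hB hσ hM hN hN' e.
  assert (hAσ : wf_ty large Γ A⟦σ⟧) by (eapply wt_sub; eauto).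
  assert (hB' : wf_ty large (Γ ▸ A⟦σ⟧) B⟦wk one A⟧⟦up one A σ⟧)
    by (eapply wt_sub; eauto using wf_up_one, wf_ty_wk_one).
  assert (sub : forall K, wf_tm Δ K A ->
    eq_tm Γ (ap A B M K)⦃σ⦄
      (app A⟦σ⟧ B⟦wk one A⟧⟦up one A σ⟧ M⦃σ⦄ K⦃σ⦄) B⟦σ⟧).
  { intros K hK. eapply eq_tm_eq; [assumption | |].
    - eapply em_app_sub; eauto using wf_ty_wk_one.
    - eapply et_sub; [apply es_refl; eassumption|]. now apply eq_ty_wk_inst. }
  apply em_trans with (1 := sub N hN).
  apply em_sym, em_trans with (1 := sub N' hN'), em_sym.
  assert (hNσ : wf_tm Γ N⦃σ⦄ A⟦σ⟧) by (eapply wm_sub; eauto).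
  eapply eq_tm_eq; [assumption | |].
  - apply em_app; auto using et_refl. apply em_refl.
    eapply wf_tm_eq; [assumption | eapply wm_sub; eauto |].
    eapply et_pi_sub; eauto using wf_ty_wk_one.
  - eapply et_trans with B⟦σ⟧⟦wk one A⟦σ⟧⟧⟦inst one A⟦σ⟧ N⦃σ⦄⟧.
    + eapply et_sub; [apply es_refl; now apply wf_inst_one|].
      eapply eq_ty_square; eauto using wf_up_one, wf_wk_one, wk_up_one.
    + apply eq_ty_wk_inst; auto. eapply wt_sub; eauto.
Qed.

(** * Modalities *)

Section Modsub.
Context {n m o} (Γ : ctx o) (ν : cell m o) (μ : cell n m) (A : ty n).
Hypotheses (hΓ : wf_ctx Γ) (hA : wf_ty large (Γ ◂ ν ◂ μ) A).

Lemma wf_ctx_cmp : wf_ctx (Γ ▸[ν ∘ μ] A).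
Proof.
  apply wf_cext; [assumption|]. eapply wt_conv; eauto. now apply ec_cmp.
Qed.

Lemma wf_mod_var :
  wf_tm (Γ ▸[ν ∘ μ] A ◂ ν)
    (mod μ A⟦wk (ν ∘ μ) A ◃ ν ◃ μ⟧ (var (ν ∘ μ) A))
    (Modal μ A)⟦wk (ν ∘ μ) A ◃ ν⟧.
Proof.
  pose proof wf_ctx_cmp as h. pose proof (ws_wk _ _ _ h) as hw.
  eapply wf_tm_eq; [now apply wf_clock | |].
  2: { apply et_sym. eapply et_modal_sub; eauto. now apply ws_lock. }
  (* The variable lives under the single lock [ν ∘ μ], the body of [mod] under the locks [ν] and [μ]
     in turn; [ec_cmp] identifies the two contexts. *)
  apply wm_mod. eapply wm_conv; [exact (wm_var _ _ _ h) | |].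
  - apply ec_sym. now apply ec_cmp.
  - apply et_sym. eapply et_conv; [|now apply ec_cmp].
    eapply eq_ty_subst; eauto. now apply es_lock_cmp.
Qed.

Lemma wf_modsub :
  wf_sub (Γ ▸[ν ∘ μ] A) (modsub ν μ A) (Γ ▸[ν] Modal μ A).
Proof.
  apply ws_ext; [apply ws_wk, wf_ctx_cmp | now apply wt_modal |].
  apply wf_mod_var.
Qed.

Lemma wk_modsub :
  eq_sub (Γ ▸[ν ∘ μ] A) (wk ν (Modal μ A) ⊙ modsub ν μ A) (wk (ν ∘ μ) A) Γ.
Proof.
  apply es_wk_ext; [apply ws_wk, wf_ctx_cmp | now apply wt_modal |].
  apply wf_mod_var.
Qed.

(** For a constant motive, the type demanded of a branch of the modal eliminator reduces to a plain
    weakening. *)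
Lemma eq_ty_wk_modsub B :
  wf_ty large Γ B ->
  eq_ty large (Γ ▸[ν ∘ μ] A)
    B⟦wk ν (Modal μ A)⟧⟦modsub ν μ A⟧ B⟦wk (ν ∘ μ) A⟧.
Proof.
  intros. eapply eq_ty_comp; eauto using wf_modsub, wk_modsub.
  apply ws_wk, wf_cext; [assumption | now apply wt_modal].
Qed.
End Modsub.

(** * The later modality *)

Lemma wf_key_later (Γ : ctx t) (κ : cell t t) :
  wf_ctx Γ -> κ ≈ one -> wf_sub (Γ ◂ ℓ) (key κ ℓ) Γ.
Proof.
  intros hΓ hκ. eapply ws_conv.
  - apply ws_key; [exact hΓ|]. eapply le_trans; [apply hκ | apply le_ℓ].
  - apply ec_refl. now apply wf_clock.
  - now apply eq_ctx_unit.
Qed.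

Lemma wf_key (Γ : ctx t) : wf_ctx Γ -> wf_sub (Γ ◂ ℓ) (key one ℓ) Γ.
Proof. intros. apply wf_key_later; auto using cell_eq_refl. Qed.

Lemma key_unit (Γ : ctx t) (κ : cell t t) :
  wf_ctx Γ -> κ ≈ one -> eq_sub (Γ ◂ ℓ) (key κ ℓ) (key one ℓ) Γ.
Proof.
  intros hΓ hκ. eapply es_conv.
  - apply es_key; [exact hΓ | | exact hκ | apply cell_eq_refl].
    eapply le_trans; [apply hκ | apply le_ℓ].
  - apply ec_refl. now apply wf_clock.
  - now apply eq_ctx_unit.
Qed.

Lemma key_nat (Γ Δ : ctx t) σ :
  wf_ctx Γ -> wf_ctx Δ -> wf_sub Γ σ Δ ->
  eq_sub (Γ ◂ ℓ) (key one ℓ ⊙ (σ ◃ ℓ)) (σ ⊙ key one ℓ) Δ.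
Proof.
  intros. apply es_trans with ((σ ◃ one) ⊙ key one ℓ).
  - eapply es_conv; [apply es_key_nat; eauto using le_ℓ | |now apply ec_one].
    apply ec_refl. now apply wf_clock.
  - eapply es_comp; [apply es_refl; now apply wf_key | now apply es_lock_one].
Qed.

Lemma eq_ty_key_nat (Γ Δ : ctx t) A σ :
  wf_ctx Γ -> wf_ctx Δ -> wf_ty large Δ A -> wf_sub Γ σ Δ ->
  eq_ty large (Γ ◂ ℓ) A⟦key one ℓ⟧⟦σ ◃ ℓ⟧ A⟦σ⟧⟦key one ℓ⟧.
Proof.
  intros. eapply eq_ty_square; eauto using key_nat, wf_key, ws_lock.
Qed.

Lemma wf_ty_key (Γ : ctx t) A :
  wf_ctx Γ -> wf_ty large Γ A -> wf_ty large (Γ ◂ ℓ) A⟦key one ℓ⟧.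
Proof. intros. eapply wt_sub; eauto using wf_key. Qed.

Lemma wf_later (Γ : ctx t) A :
  wf_ctx Γ -> wf_ty large Γ A -> wf_ty large Γ (later A).
Proof. intros. apply wt_modal. now apply wf_ty_key. Qed.

(** This form, with the substitution kept under the lock, is the one that matches the annotation
    produced by [em_mod_sub]; [eq_later_sub] moves the key outside by naturality. *)
Lemma eq_later_sub_lock (Γ Δ : ctx t) A σ :
  wf_ctx Δ -> wf_ty large Δ A -> wf_sub Γ σ Δ ->
  eq_ty large Γ (later A)⟦σ⟧ (Modal ℓ A⟦key one ℓ⟧⟦σ ◃ ℓ⟧).
Proof. intros. eapply et_modal_sub; eauto using wf_ty_key. Qed.

Lemma eq_later_sub (Γ Δ : ctx t) A σ :
  wf_ctx Γ -> wf_ctx Δ -> wf_ty large Δ A -> wf_sub Γ σ Δ ->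
  eq_ty large Γ (later A)⟦σ⟧ (later A⟦σ⟧).
Proof.
  intros. eapply et_trans; [eapply eq_later_sub_lock; eauto|].
  apply et_modal; eauto using cell_eq_refl, eq_ty_key_nat.
Qed.

(** * Typing and computation of [next] *)

Section Next.
Context (Γ : ctx t) (A : ty t).
Hypotheses (hΓ : wf_ctx Γ) (hA : wf_ty large Γ A).

Local Notation κ := (@one t ∘ one).
Local Notation Γκ := (Γ ▸[κ] A).

Lemma wf_ty_one_one : wf_ty large (Γ ◂ one ◂ one) A.
Proof.
  do 2 (apply wf_ty_unit; auto using cell_eq_refl, wf_clock).
Qed.

Lemma wf_ctx_next : wf_ctx Γκ.
Proof. apply wf_ctx_cmp; auto using wf_ty_one_one. Qed.

Lemma wf_wk_next : wf_sub Γκ (wk κ A) Γ.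
Proof. apply ws_wk, wf_ctx_next. Qed.

Lemma wf_var_next : wf_tm Γκ (var κ A) A⟦wk κ A⟧.
Proof.
  eapply wm_conv; [apply wm_var, wf_ctx_next | |].
  - apply eq_ctx_unit; [apply wf_ctx_next | apply one_one].
  - eapply et_conv;
      [|apply ec_sym, eq_ctx_unit; [apply wf_ctx_next | apply one_one]].
    eapply eq_ty_subst; eauto.
    apply lock_unit; auto using wf_ctx_next, one_one, wf_wk_next.
Qed.

(** The variable under its key has the left-hand type, while the annotation in [next] is the
    right-hand one. They agree by naturality of the key with respect to weakening. *)
Lemma eq_ty_key_wk_next :
  eq_ty large (Γκ ◂ ℓ) A⟦wk κ A⟧⟦key κ ℓ⟧ A⟦key one ℓ⟧⟦wk κ A ◃ ℓ⟧.
Proof.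
  eapply eq_ty_square.
  - apply wf_key_later; [apply wf_ctx_next | apply one_one].
  - apply wf_wk_next.
  - apply ws_lock, wf_wk_next.
  - now apply wf_key.
  - assumption.
  - eapply es_trans.
    + eapply es_comp; [apply key_unit; auto using wf_ctx_next, one_one|].
      apply es_refl, wf_wk_next.
    + apply es_sym, key_nat; auto using wf_ctx_next, wf_wk_next.
Qed.

Lemma wf_key_var_next :
  wf_tm (Γκ ◂ ℓ) (var κ A)⦃key κ ℓ⦄ A⟦key one ℓ⟧⟦wk κ A ◃ ℓ⟧.
Proof.
  eapply wf_tm_eq; [apply wf_clock, wf_ctx_next | |apply eq_ty_key_wk_next].
  eapply wm_sub; [|apply wf_var_next].
  apply wf_key_later; [apply wf_ctx_next | apply one_one].
Qed.

Lemma wf_next_branch :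
  wf_tm Γκ (mod ℓ A⟦key one ℓ⟧⟦wk κ A ◃ ℓ⟧ (var κ A)⦃key κ ℓ⦄)
    (later A)⟦wk one (Modal one A)⟧⟦modsub one one A⟧.
Proof.
  eapply wf_tm_eq; [apply wf_ctx_next | apply wm_mod, wf_key_var_next |].
  apply et_sym. eapply et_trans.
  - apply eq_ty_wk_modsub; auto using wf_ty_one_one, wf_later.
  - eapply eq_later_sub_lock; eauto. apply wf_wk_next.
Qed.

Lemma wf_ty_next_motive :
  wf_ty large (Γ ▸ Modal one A) (later A)⟦wk one (Modal one A)⟧.
Proof.
  apply wf_ty_wk_one; auto using wf_later.
  apply wt_modal. apply wf_ty_unit; auto using cell_eq_refl.
Qed.

Context (N : tm t).
Hypothesis hN : wf_tm Γ N A.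

Lemma wf_mod_one : wf_tm Γ (mod one A N) (Modal one A).
Proof. apply wm_mod. now apply wf_tm_one. Qed.

Lemma wf_tm_one_one : wf_tm (Γ ◂ one ◂ one) N A.
Proof.
  apply wf_tm_one; auto using wf_clock, wf_tm_one, wf_ty_unit, cell_eq_refl.
Qed.

Lemma eq_ty_next_motive :
  eq_ty large Γ
    (later A)⟦wk one (Modal one A)⟧⟦inst one (Modal one A) (mod one A N)⟧
    (later A).
Proof.
  apply eq_ty_wk_inst; auto using wf_later, wf_mod_one.
  apply wt_modal. apply wf_ty_unit; auto using cell_eq_refl.
Qed.

Lemma wf_next : wf_tm Γ (next A N) (later A).
Proof.
  eapply wf_tm_eq; [assumption | |apply eq_ty_next_motive].
  apply wm_let; auto using wf_ty_one_one, wf_ty_next_motive, wf_next_branch.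
  apply wf_tm_one; auto using wf_mod_one.
  apply wt_modal. apply wf_ty_unit; auto using cell_eq_refl.
Qed.

Lemma wf_tm_key : wf_tm (Γ ◂ ℓ) N⦃key one ℓ⦄ A⟦key one ℓ⟧.
Proof. eapply wm_sub; eauto using wf_key. Qed.

Lemma wf_inst_next : wf_sub Γ (inst κ A N) Γκ.
Proof.
  apply wf_inst; [assumption | apply wf_ty_unit; auto using one_one |].
  eapply wm_conv; eauto; [|now apply et_refl].
  apply ec_sym, eq_ctx_unit; auto using one_one.
Qed.

Lemma wk_inst_next : eq_sub Γ (wk κ A ⊙ inst κ A N) id Γ.
Proof.
  apply wk_inst; [assumption | apply wf_ty_unit; auto using one_one |].
  eapply wm_conv; eauto; [|now apply et_refl].
  apply ec_sym, eq_ctx_unit; auto using one_one.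
Qed.

Lemma eq_var_inst_next : eq_tm Γ (var κ A)⦃inst κ A N⦄ N A.
Proof.
  assert (h : eq_ctx (Γ ◂ κ) Γ) by (apply eq_ctx_unit; auto using one_one).
  assert (hNκ : wf_tm (Γ ◂ κ) N A)
    by (eapply wm_conv; [eauto | now apply ec_sym | now apply et_refl]).
  assert (e : eq_ty large Γ A⟦id ◃ κ⟧ A).
  { eapply et_trans; [|now apply et_id]. eapply eq_ty_subst; eauto.
    apply lock_unit; auto using one_one, ws_id. }
  (* The computation rule for variables speaks of a locked substitution; the lock [κ] can be
     inserted because [κ ≈ one]. *)
  apply em_trans with ((var κ A)⦃inst κ A N ◃ κ⦄).
  - eapply eq_tm_eq; [assumption | |].
    + eapply em_sub; [|apply em_refl, wf_var_next].
      apply es_sym, lock_unit;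
        auto using wf_ctx_next, one_one, wf_inst_next.
    + eapply eq_ty_comp_id; eauto using wf_inst_next, wf_wk_next, wk_inst_next.
      - eapply em_conv; [eapply em_var_ext | exact h |].
    + now apply ws_id.
    + apply wf_ty_unit; auto using one_one.
    + eapply wf_tm_eq; [now apply wf_clock | exact hNκ |].
      apply et_sym. eapply et_conv; [exact e | now apply ec_sym].
    + eapply et_conv; [exact e | now apply ec_sym].
Qed.

(** The scrutinee of the eliminator in [next] is already of the form [mod], so β fires. The
    resulting instantiation is pushed under [mod ℓ] and then, by naturality, past the key to the
    variable, which it replaces by [N]. *)
Lemma next_beta : eq_tm Γ (next A N) (mod ℓ A⟦key one ℓ⟧ N⦃key one ℓ⦄) (later A).
Proof.
  pose proof wf_inst_next as hi. pose proof wf_ctx_next as hc.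
  (* Under the lock, instantiation still cancels weakening, since locking preserves composition and
     identity. *)
  assert (eA : eq_ty large (Γ ◂ ℓ)
    A⟦key one ℓ⟧⟦wk κ A ◃ ℓ⟧⟦inst κ A N ◃ ℓ⟧ A⟦key one ℓ⟧).
  { eapply eq_ty_comp_id.
    - apply ws_lock, hi.
    - apply ws_lock, wf_wk_next.
    - now apply wf_ty_key.
    - eapply es_trans; [apply es_sym; eapply es_lock_comp; eauto using wf_wk_next|].
      eapply es_trans; [|now apply es_lock_id].
      apply es_lock; [apply wk_inst_next | apply cell_eq_refl]. }
  apply em_trans with
    ((mod ℓ A⟦key one ℓ⟧⟦wk κ A ◃ ℓ⟧ (var κ A)⦃key κ ℓ⦄)⦃inst κ A N⦄).
  { eapply eq_tm_eq; [assumption | |apply eq_ty_next_motive].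
    apply em_let_beta;
      auto using wf_ty_next_motive, wf_tm_one_one, wf_next_branch. }
  apply em_trans with
    (mod ℓ A⟦key one ℓ⟧⟦wk κ A ◃ ℓ⟧⟦inst κ A N ◃ ℓ⟧
      (var κ A)⦃key κ ℓ⦄⦃inst κ A N ◃ ℓ⦄).
  { eapply eq_tm_eq;
      [assumption | eapply em_mod_sub; eauto using wf_key_var_next |].
    eapply et_trans.
    - eapply et_modal_sub; eauto. eapply wt_sub.
      + apply ws_lock, wf_wk_next.
      + now apply wf_ty_key.
    - apply et_modal; [apply cell_eq_refl | exact eA]. }
  eapply eq_tm_eq; [assumption | |apply et_modal; [apply cell_eq_refl | exact eA]].
  apply em_mod; [apply cell_eq_refl | exact eA |].
  eapply eq_tm_eq; [now apply wf_clock | |apply et_sym, eA].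
  assert (eT : eq_ty large (Γ ◂ ℓ) A⟦wk κ A⟧⟦key κ ℓ⟧⟦inst κ A N ◃ ℓ⟧ A⟦key one ℓ⟧).
  { eapply et_trans; [|exact eA].
    eapply et_sub; [apply es_refl, ws_lock, hi | apply eq_ty_key_wk_next]. }
  (* Naturality exchanges the key and the instantiation. *)
  apply em_trans with (var κ A)⦃inst κ A N⦄⦃key one ℓ⦄.
  - eapply eq_tm_eq; [now apply wf_clock | |exact eT].
    eapply eq_tm_square.
    + now apply wf_clock.
    + apply ws_lock, hi.
    + apply wf_key_later; [exact hc | apply one_one].
    + now apply wf_key.
    + exact hi.
    + eapply wt_sub; eauto using wf_wk_next.
    + apply wf_var_next.
    + eapply es_trans; [|apply key_nat; eauto].
      eapply es_comp; [apply es_refl, ws_lock, hi |].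
      apply key_unit; [exact hc | apply one_one].
  - eapply em_sub; [apply es_refl; now apply wf_key | apply eq_var_inst_next].
Qed.
End Next.

(** * Löb induction *)

Lemma wf_löb_at (Γ : ctx t) A M :
  wf_ctx Γ -> wf_ty large Γ A -> wf_tm Γ M (arr (later A) A) ->
  wf_tm Γ (löb_at A M) A.
Proof.
  intros. apply wf_ap; auto using wf_arr, wf_later, wm_löb.
Qed.

(** The induction hypothesis is a variable of modality [ℓ] rather than one of type [later E]: it can
    then be used directly under a lock [ℓ], where reflection will be applied to it. Eliminating the
    modal type converts between the two forms. *)
Lemma löb_induction (Γ : ctx t) E P :
  wf_ctx Γ -> wf_ty large Γ E ->
  wf_tm (Γ ▸[ℓ] E⟦key one ℓ⟧) P E⟦wk ℓ E⟦key one ℓ⟧⟧ ->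
  exists Q, wf_tm Γ Q E.
Proof.
  intros hΓ hE hP.
  pose proof (wf_later _ _ hΓ hE) as hL.
  pose proof (wf_ty_key _ _ hΓ hE) as hK.
  pose proof (wf_ctx_ext _ _ hΓ hL) as hΓL.
  pose proof (wf_wk_one _ _ hΓ hL) as hw.
  set (ΓL := Γ ▸ later E) in *. set (w := wk one (later E)) in *.
  (* [X] is the type under the modality once [later E] has been weakened, which is what the
     eliminator has to be annotated with. *)
  set (X := E⟦key one ℓ⟧⟦w ◃ ℓ⟧).
  assert (hX : wf_ty large (ΓL ◂ ℓ) X)
    by exact (wt_sub _ _ _ _ _ (ws_lock _ _ ℓ _ hw) hK).
  assert (hX1 : wf_ty large (ΓL ◂ one ◂ ℓ) X).
  { eapply wt_conv; [exact hX|]. apply ec_clock; [|apply cell_eq_refl].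
    apply ec_sym. now apply ec_one. }
  assert (hEw : wf_ty large ΓL E⟦w⟧) by (eapply wt_sub; eauto).
  assert (hv : wf_tm ΓL (var one (later E)) (Modal ℓ X)).
  { eapply wf_tm_eq; [assumption | now apply wf_var_one|].
    now apply (eq_later_sub_lock _ Γ). }
  (* The eliminator with framing [one] binds its variable at [one ∘ ℓ] instead of [ℓ]. *)
  assert (hc : eq_ctx (ΓL ▸[ℓ] X) (ΓL ▸[one ∘ ℓ] X)).
  { apply ec_cext; auto using ec_refl, et_refl.
    split; apply one_cmp. }
  assert (hMX : wf_ty large ΓL (Modal ℓ X)) by now apply wt_modal.
  (* The witness is löb(λy. let mod_ℓ(z) ← y in P), with [P] transported along the lifting of [w]
     because [y] is also in scope. *)
  exists (löb_at E (lam (later E) E⟦w⟧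
    (letmod one ℓ X E⟦w⟧⟦wk one (Modal ℓ X)⟧ (var one (later E))
      P⦃up ℓ E⟦key one ℓ⟧ w⦄))).
  apply wf_löb_at; auto.
  apply wm_lam; auto.
  eapply wf_tm_eq; [assumption | |exact (eq_ty_wk_inst _ _ _ _ hΓL hMX hEw hv)].
  apply wm_let; auto using wf_ty_wk_one.
  { now apply wf_tm_one. }
  pose proof (wf_up _ _ _ _ _ hΓL hK hw) as hup.
  eapply wm_conv; [exact (wm_sub _ _ _ _ _ hup hP) | exact hc |].
  apply et_trans with (E⟦w⟧⟦wk ℓ X⟧).
  - eapply eq_ty_square.
    + exact hup.
    + apply ws_wk. now apply wf_cext.
    + apply ws_wk. now apply wf_cext.
    + exact hw.
    + exact hE.
    + now apply wk_up.
  - apply et_trans with (E⟦w⟧⟦wk (one ∘ ℓ) X⟧).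
    + eapply eq_ty_subst; eauto. apply es_wk; auto using et_refl.
      split; apply one_cmp.
    + apply et_conv with (ΓL ▸[one ∘ ℓ] X); [|now apply ec_sym].
      apply et_sym. now apply eq_ty_wk_modsub.
Qed.

(** Here equality reflection is used under the lock. Both sides are reduced by [next_beta] over [Γ]
    before [σ] is applied, so that only the substitution law of [mod] is called for, not one for
    [next]. *)
Lemma eq_next_sub (Γ Δ : ctx t) A N N' P σ :
  wf_ctx Γ -> wf_ctx Δ -> wf_sub Δ σ Γ -> wf_ty large Γ A ->
  wf_tm Γ N A -> wf_tm Γ N' A ->
  wf_tm (Δ ◂ ℓ) P (Eq A N N')⟦σ⟧⟦key one ℓ⟧ ->
  eq_tm Δ (next A N)⦃σ⦄ (next A N')⦃σ⦄ (later A)⟦σ⟧.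
Proof.
  intros hΓ hΔ hσ hA hN hN' hP.
  pose proof (wf_key _ hΔ) as hk. pose proof (wf_key _ hΓ) as hk'.
  pose proof (ws_lock _ _ ℓ _ hσ) as hσℓ.
  pose proof (wf_clock _ ℓ hΔ) as hΔℓ.
  assert (hAσ : wf_ty large Δ A⟦σ⟧) by (eapply wt_sub; eauto).
  assert (hAk : wf_ty large (Γ ◂ ℓ) A⟦key one ℓ⟧) by now apply wf_ty_key.
  assert (beta : forall K, wf_tm Γ K A -> eq_tm Δ (next A K)⦃σ⦄
    (mod ℓ A⟦key one ℓ⟧⟦σ ◃ ℓ⟧ K⦃key one ℓ⦄⦃σ ◃ ℓ⦄) (later A)⟦σ⟧).
  { intros K hK. apply em_trans with (mod ℓ A⟦key one ℓ⟧ K⦃key one ℓ⦄)⦃σ⦄.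
    - eapply em_sub; [eapply es_refl; eassumption | now apply next_beta].
    - eapply em_mod_sub; [eassumption | now apply wf_tm_key]. }
  apply em_trans with (1 := beta N hN).
  apply em_sym, em_trans with (1 := beta N' hN'), em_sym.
  eapply eq_tm_eq; [assumption | |apply et_sym; now apply (eq_later_sub_lock _ Γ)].
  apply em_mod; [apply cell_eq_refl | apply et_refl; eapply wt_sub; eauto |].
  assert (swap : forall K, wf_tm Γ K A -> eq_tm (Δ ◂ ℓ)
    K⦃key one ℓ⦄⦃σ ◃ ℓ⦄ K⦃σ⦄⦃key one ℓ⦄ A⟦key one ℓ⟧⟦σ ◃ ℓ⟧)
    by (intros; eapply eq_tm_square; eauto using key_nat).
  apply em_trans with (1 := swap N hN).
  apply em_sym, em_trans with (1 := swap N' hN'), em_sym.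
  apply eq_tm_eq with A⟦σ⟧⟦key one ℓ⟧;
    [assumption | |apply et_sym; now apply (eq_ty_key_nat _ Γ)].
  (* The goal is now N^{1≤ℓ} = N'^{1≤ℓ} after [σ], and [P] inhabits the corresponding equality type
     once both substitutions are distributed over [Eq]. *)
  apply em_reflection with P.
  - now apply wf_ty_key.
  - exact (wm_sub _ _ _ _ _ hk (wm_sub _ _ _ _ _ hσ hN)).
  - exact (wm_sub _ _ _ _ _ hk (wm_sub _ _ _ _ _ hσ hN')).
  - eapply wf_tm_eq; [assumption | exact hP |].
    eapply et_trans.
    + eapply et_sub; [eapply es_refl; eassumption | now apply (et_eq_sub _ _ Γ)].
    + apply (et_eq_sub _ _ Δ); auto; eapply wm_sub; eauto.
Qed.

(** The fixed-point equations are required only after [σ], since in the application one of them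
    comes from a hypothesis variable and holds only in the extended context. *)
Lemma guarded_fixpoint_unique (Γ Δ : ctx t) A M N N' σ :
  wf_ctx Γ -> wf_ctx Δ -> wf_sub Δ σ Γ -> wf_ty large Γ A ->
  wf_tm Γ M (arr (later A) A) -> wf_tm Γ N A -> wf_tm Γ N' A ->
  eq_tm Δ N⦃σ⦄ (ap (later A) A M (next A N))⦃σ⦄ A⟦σ⟧ ->
  eq_tm Δ N'⦃σ⦄ (ap (later A) A M (next A N'))⦃σ⦄ A⟦σ⟧ ->
  exists P, wf_tm Δ P (Eq A N N')⟦σ⟧.
Proof.
  intros hΓ hΔ hσ hA hM hN hN' e e'.
  assert (hE : wf_ty large Γ (Eq A N N')) by now apply wt_eq.
  set (E := (Eq A N N')⟦σ⟧).
  assert (hEσ : wf_ty large Δ E) by (eapply wt_sub; eauto).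
  assert (hK : wf_ctx (Δ ▸[ℓ] E⟦key one ℓ⟧))
    by (apply wf_cext; auto using wf_ty_key).
  pose proof (ws_wk _ _ _ hK) as hw.
  set (ΔK := Δ ▸[ℓ] E⟦key one ℓ⟧) in *. set (w := wk ℓ E⟦key one ℓ⟧) in *.
  assert (hσw : wf_sub ΔK (σ ⊙ w) Γ) by (eapply ws_comp; eauto).
  assert (eE : eq_ty large ΔK E⟦w⟧ (Eq A N N')⟦σ ⊙ w⟧)
    by (apply et_sym; eapply et_comp; eauto).
  assert (next_eq : eq_tm ΔK (next A N)⦃σ ⊙ w⦄ (next A N')⦃σ ⊙ w⦄
    (later A)⟦σ ⊙ w⟧).
  (* The Löb hypothesis itself, as a variable under the lock [ℓ], is the proof to be reflected. *)
  { apply (eq_next_sub Γ) with (var ℓ E⟦key one ℓ⟧); auto. eapply wf_tm_eq.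
    - now apply wf_clock.
    - now apply wm_var.
    - eapply et_trans; [now apply (eq_ty_key_nat _ Δ)|].
      eapply et_sub; [apply es_refl; now apply wf_key | exact eE]. }
  assert (unfold : forall K, wf_tm Γ K A ->
    eq_tm Δ K⦃σ⦄ (ap (later A) A M (next A K))⦃σ⦄ A⟦σ⟧ ->
    eq_tm ΔK K⦃σ ⊙ w⦄ (ap (later A) A M (next A K))⦃σ ⊙ w⦄ A⟦σ ⊙ w⟧).
  { intros K hK' eK.
    apply em_trans with K⦃σ⦄⦃w⦄; [eapply em_comp; eauto|].
    apply em_trans with (ap (later A) A M (next A K))⦃σ⦄⦃w⦄.
    - eapply eq_tm_eq; [assumption | |apply et_sym; eapply et_comp; eauto].
      eapply em_sub; eauto using es_refl.
    - apply em_sym. eapply em_comp; eauto.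
      apply wf_ap; auto using wf_later, wf_next. }
  (* Reflexivity suffices once its type is converted along N = f(next N) = f(next N') = N'. *)
  apply löb_induction with (refl A⟦σ ⊙ w⟧ N⦃σ ⊙ w⦄); auto.
  eapply wf_tm_eq; [assumption | |apply et_sym, eE].
  eapply wf_tm_eq; [assumption | |apply et_sym; eapply et_eq_sub; eauto].
  assert (hNσ : wf_tm ΔK N⦃σ ⊙ w⦄ A⟦σ ⊙ w⟧) by (eapply wm_sub; eauto).
  eapply wf_tm_eq; [assumption | now apply wm_refl |].
  apply et_eq; [apply et_refl; eapply wt_sub; eauto | now apply em_refl |].
  apply em_trans with (1 := unfold N hN e).
  apply em_sym, em_trans with (1 := unfold N' hN' e'), em_sym.
  apply (eq_ap_sub _ Γ); auto using wf_later, wf_next.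
Qed.

Theorem theorem9p5 (Γ : ctx t) (A M : tm t)
  (hΓ : wf_ctx Γ)
  (hA : wf_tm Γ A U)
  (hM : wf_tm Γ M (arr (later (El A)) (El A))) :
  exists P : tm t, wf_tm Γ P (löb_unique (El A) M).
Proof.
  assert (hT : wf_ty large Γ (El A)) by now apply wt_lift, wt_El.
  pose proof (wf_ctx_ext _ _ hΓ hT) as hΓ1.
  pose proof (wf_wk_one _ _ hΓ hT) as hw.
  pose proof (wf_var_one _ _ hΓ hT) as hx.
  pose proof (wf_ty_wk_one _ _ _ hΓ hT hT) as hT'.
  unfold löb_unique; cbv zeta.
  set (w := wk one (El A)) in *. set (T := (El A)⟦w⟧) in *.
  set (x := var one (El A)) in *.
  (* The weakened function has a weakened arrow type; its domain becomes [later T] because [later]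
     commutes with substitution. *)
  assert (hf : wf_tm (Γ ▸ El A) M⦃w⦄ (arr (later T) T)).
  { eapply wf_tm_eq; [assumption | eapply wm_sub; eauto |].
    apply (eq_arr_sub _ Γ); auto using wf_later.
    now apply (eq_later_sub _ Γ). }
  set (fx := ap (later T) T M⦃w⦄ (next T x)).
  assert (hfx : wf_tm (Γ ▸ El A) fx T)
    by (apply wf_ap; auto using wf_later, wf_next).
  set (H := Eq T fx x).
  assert (hH : wf_ty large (Γ ▸ El A) H) by now apply wt_eq.
  pose proof (wf_wk_one _ _ hΓ1 hH) as hwH.
  pose proof (wf_ctx_ext _ _ hΓ1 hH) as hΓ2.
  pose proof (wf_löb_at _ _ _ hΓ1 hT' hf) as hL.
  assert (hC : wf_ty large (Γ ▸ El A) (Eq T (löb_at T M⦃w⦄) x))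
    by now apply wt_eq.
  (* The substitution is weakening by [H], the assumption that [x] is a fixed point. *)
  destruct (guarded_fixpoint_unique (Γ ▸ El A) (Γ ▸ El A ▸ H) T M⦃w⦄
    (löb_at T M⦃w⦄) x (wk one H)) as [P hP]; auto.
  - eapply em_sub; [eapply es_refl; eassumption | now apply em_löb_unfold].
  (* Reflecting the assumed equality makes [x] a judgmental fixed point over the extended
     context. *)
  - apply em_sym. apply em_reflection with (var one H).
    + now apply wf_ty_wk_one.
    + eapply wm_sub; eauto.
    + eapply wm_sub; eauto.
    + eapply wf_tm_eq; [assumption | now apply wf_var_one |].
      eapply et_eq_sub; eauto.
  - exists (lam (El A) (arr H (Eq T (löb_at T M⦃w⦄) x))
      (lam H (Eq T (löb_at T M⦃w⦄) x)⟦wk one H⟧ P)).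
    apply wm_lam; auto using wf_arr.
    apply wm_lam; auto using wf_ty_wk_one.
Qed.
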